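(* There is a one-to-one correspondence between $2$-term skeletal operator homotopy post-Lie algebras and triples $((\mathfrak h,[\cdot,\cdot]_{\mathfrak h},\rhd),(V;\rho,\mu,\nu),\omega)$, where $(\mathfrak h,[\cdot,\cdot]_{\mathfrak h},\rhd)$ is a post-Lie algebra, $(V;\rho,\mu,\nu)$ is a representation of the post-Lie algebra $(\mathfrak h,[\cdot,\cdot]_{\mathfrak h},\rhd)$, and $\omega\in\mathrm{Hom}(\wedge^2\mathfrak h\otimes\mathfrak h,V)$ is a $3$-cocycle of $(\mathfrak h,[\cdot,\cdot]_{\mathfrak h},\rhd)$ with coefficients in $(V;\rho,\mu,\nu)$.
   Context: Vector spaces are over a field of characteristic zero. A post-Lie algebra $(\mathfrak h,[\cdot,\cdot]_{\mathfrak h},\rhd)$ is a Lie algebra with a binary product $\rhd:\mathfrak h\otimes\mathfrak h\to\mathfrak h$ such that $x\rhd[y,z]_{\mathfrak h}=[x\rhd y,z]_{\mathfrak h}+[y,x\rhd z]_{\mathfrak h}$ and $[x,y]_{\mathfrak h}\rhd z=a_\rhd(x,y,z)-a_\rhd(y,x,z)$, where $a_\rhd(x,y,z)=x\rhd(y\rhd z)-(x\rhd y)\rhd z$. A representation of it on a vector space $V$ is a triple $(\rho,\mu,\nu)$ with $\rho:\mathfrak h\to\mathfrak{gl}(V)$ a representation of the Lie algebra $(\mathfrak h,[\cdot,\cdot]_{\mathfrak h})$ and $\mu,\nu:\mathfrak h\to\mathfrak{gl}(V)$ linear such that for all $x,y\in\mathfrak h$: $\rho(x\rhd y)=\mu(x)\rho(y)-\rho(y)\mu(x)$;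 $\nu([x,y]_{\mathfrak h})=\rho(x)\nu(y)-\rho(y)\nu(x)$; $\mu([x,y]_{\mathfrak h})=\mu(x)\mu(y)-\mu(x\rhd y)-\mu(y)\mu(x)+\mu(y\rhd x)$; $\nu(y)\rho(x)=\mu(x)\nu(y)-\nu(y)\mu(x)-\nu(x\rhd y)+\nu(y)\nu(x)$. Cochains: $\mathrm{Der}(\mathfrak h,V)=\{f\in\mathrm{Hom}(\mathfrak h,V)\mid f([x,y]_{\mathfrak h})=\rho(x)f(y)-\rho(y)f(x)\ \forall x,y\in\mathfrak h\}$; for $n\ge1$, $C_{\mathrm{Der}}^n(\mathfrak h,V)$ is the set of $f\in\mathrm{Hom}(\wedge^{n-1}\mathfrak h\otimes\mathfrak h,V)$ with $f(x_1,\dots,x_{n-1},\cdot)\in\mathrm{Der}(\mathfrak h,V)$ for all $x_1,\dots,x_{n-1}\in\mathfrak h$. The coboundary is $$\begin{aligned}(\delta f)(x_1,\dots,x_{n+1})=&\sum_{i=1}^n(-1)^{i+1}\mu(x_i)f(x_1,\dots,\hat x_i,\dots,x_n,x_{n+1})+\sum_{i=1}^n(-1)^{i+1}\nu(x_{n+1})f(x_1,\dots,\hat x_i,\dots,x_n,x_i)\\&-\sum_{i=1}^n(-1)^{i+1}f(x_1,\dots,\hat x_i,\dots,x_n,x_i\rhd x_{n+1})\\&+\sum_{1\le i<j\le n}(-1)^{i+j}f(x_i\rhd x_j-x_j\rhd x_i+[x_i,x_j]_{\mathfrak h},x_1,\dots,\hat x_i,\dots,\hat x_j,\dots,x_n,x_{n+1}).\end{aligned}$$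 A $3$-cocycle is $\omega\in C_{\mathrm{Der}}^3(\mathfrak h,V)$ with $\delta\omega=0$. A $2$-term operator homotopy post-Lie algebra is a $2$-term graded Lie algebra $(\mathfrak g=\mathfrak g_0\oplus\mathfrak g_{-1},[\cdot,\cdot]_{\mathfrak g})$ (degree $0$ bracket, so $[\mathfrak g_{-1},\mathfrak g_{-1}]_{\mathfrak g}=0$) with linear maps $\Theta_1:\mathfrak g_{-1}\to\mathfrak g_0$; $\Theta_2:\mathfrak g_i\otimes\mathfrak g_j\to\mathfrak g_{i+j}$ for $-1\le i+j\le0$; $\Theta_3:\wedge^2\mathfrak g_0\otimes\mathfrak g_0\to\mathfrak g_{-1}$, such that for all $x,y,z,w\in\mathfrak g_0$, $a,b\in\mathfrak g_{-1}$: (a1) $\Theta_1([x,a]_{\mathfrak g})=[x,\Theta_1(a)]_{\mathfrak g}$; (a2) $[\Theta_1(a),b]_{\mathfrak g}=[a,\Theta_1(b)]_{\mathfrak g}$; (b1) $\Theta_2(x,[y,z]_{\mathfrak g})=[\Theta_2(x,y),z]_{\mathfrak g}+[y,\Theta_2(x,z)]_{\mathfrak g}$; (b2) $\Theta_2(x,[y,a]_{\mathfrak g})=[\Theta_2(x,y),a]_{\mathfrak g}+[y,\Theta_2(x,a)]_{\mathfrak g}$; (b3) $\Theta_2(a,[x,y]_{\mathfrak g})=[\Theta_2(a,x),y]_{\mathfrak g}+[x,\Theta_2(a,y)]_{\mathfrak g}$; (c) $\Theta_3(x,y,[z,w]_{\mathfrak g})=[\Theta_3(x,y,z),w]_{\mathfrak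 g}+[z,\Theta_3(x,y,w)]_{\mathfrak g}$; (d1) $\Theta_1\Theta_2(x,a)=\Theta_2(x,\Theta_1(a))$; (d2) $\Theta_1\Theta_2(a,x)=\Theta_2(\Theta_1(a),x)$; (d3) $\Theta_2(\Theta_1(a),b)=\Theta_2(a,\Theta_1(b))$; (e1) $\Theta_2(x,\Theta_2(y,z))-\Theta_2(\Theta_2(x,y),z)-\Theta_2(y,\Theta_2(x,z))+\Theta_2(\Theta_2(y,x),z)-\Theta_2([x,y]_{\mathfrak g},z)=\Theta_1\Theta_3(x,y,z)$; (e2) $\Theta_2(x,\Theta_2(y,a))-\Theta_2(\Theta_2(x,y),a)-\Theta_2(y,\Theta_2(x,a))+\Theta_2(\Theta_2(y,x),a)-\Theta_2([x,y]_{\mathfrak g},a)=\Theta_3(x,y,\Theta_1(a))$; (e3) $\Theta_2(a,\Theta_2(y,z))-\Theta_2(\Theta_2(a,y),z)-\Theta_2(y,\Theta_2(a,z))+\Theta_2(\Theta_2(y,a),z)-\Theta_2([a,y]_{\mathfrak g},z)=\Theta_3(\Theta_1(a),y,z)$; (f) $\Theta_2(x,\Theta_3(y,z,w))-\Theta_2(y,\Theta_3(x,z,w))+\Theta_2(z,\Theta_3(x,y,w))+\Theta_2(\Theta_3(y,z,x),w)-\Theta_2(\Theta_3(x,z,y),w)+\Theta_2(\Theta_3(x,y,z),w)-\Theta_3(\Theta_2(x,y)-\Theta_2(y,x)+[x,y]_{\mathfrak g},z,w)-\Theta_3(\Theta_2(y,z)-\Theta_2(z,y)+[y,z]_{\mathfrak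 g},x,w)+\Theta_3(\Theta_2(x,z)-\Theta_2(z,x)+[x,z]_{\mathfrak g},y,w)-\Theta_3(y,z,\Theta_2(x,w))+\Theta_3(x,z,\Theta_2(y,w))-\Theta_3(x,y,\Theta_2(z,w))=0$. It is called skeletal if $\Theta_1=0$. *)

(* Defs.v *)
From HB Require Import structures.
From mathcomp Require Import all_boot all_order all_algebra.

Set Implicit Arguments.
Unset Strict Implicit.
Unset Printing Implicit Defensive.

Import GRing.Theory.
Local Open Scope ring_scope.

Notation bilinear f := (bilinear_for *:%R *:%R f).

(* The binary products, actions and operators below are curried functions with
   a linearity hypothesis; a linear map h -> gl(V) is thus a bilinear map
   h -> V -> V. *)

Section PostLie.
Variable K : fieldType.

Record is_lie (h : lmodType K) (br : h -> h -> h) : Prop := IsLie {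
  lie_bilinear : bilinear br;
  lie_alternating : forall x, br x x = 0;
  lie_jacobi : forall x y z,
    br x (br y z) = br (br x y) z + br y (br x z)
}.

Definition assoc (h : lmodType K) (tr : h -> h -> h) (x y z : h) : h :=
  tr x (tr y z) - tr (tr x y) z.

Record postLie (h : lmodType K) := PostLie {
  pl_br : h -> h -> h;
  pl_tr : h -> h -> h;
  pl_br_lie : is_lie pl_br;
  pl_tr_bilinear : bilinear pl_tr;
  pl_tr_derivation : forall x y z,
    pl_tr x (pl_br y z) = pl_br (pl_tr x y) z + pl_br y (pl_tr x z);
  pl_br_tr : forall x y z,
    pl_tr (pl_br x y) z = assoc pl_tr x y z - assoc pl_tr y x z
}.

Record postLieRep (h : lmodType K) (P : postLie h) (V : lmodType K) :=
  PostLieRep {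
  rep_rho : h -> V -> V;
  rep_mu : h -> V -> V;
  rep_nu : h -> V -> V;
  rep_rho_bilinear : bilinear rep_rho;
  rep_mu_bilinear : bilinear rep_mu;
  rep_nu_bilinear : bilinear rep_nu;
  rep_rho_br : forall x y v,
    rep_rho (pl_br P x y) v
      = rep_rho x (rep_rho y v) - rep_rho y (rep_rho x v);
  rep_rho_tr : forall x y v,
    rep_rho (pl_tr P x y) v
      = rep_mu x (rep_rho y v) - rep_rho y (rep_mu x v);
  rep_nu_br : forall x y v,
    rep_nu (pl_br P x y) v
      = rep_rho x (rep_nu y v) - rep_rho y (rep_nu x v);
  rep_mu_br : forall x y v,
    rep_mu (pl_br P x y) v
      = rep_mu x (rep_mu y v) - rep_mu (pl_tr P x y) v
        - rep_mu y (rep_mu x v) + rep_mu (pl_tr P y x) v;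
  rep_nu_rho : forall x y v,
    rep_nu y (rep_rho x v)
      = rep_mu x (rep_nu y v) - rep_nu y (rep_mu x v)
        - rep_nu (pl_tr P x y) v + rep_nu y (rep_nu x v)
}.

Section Cohomology.
Variables (h V : lmodType K) (P : postLie h) (R : postLieRep P V).

Record is_Der (f : h -> V) : Prop := IsDer {
  der_linear : linear f;
  der_br : forall x y,
    f (pl_br P x y) = rep_rho R x (f y) - rep_rho R y (f x)
}.

Definition tupd m (x : m.-tuple h) (i : 'I_m) (u : h) : m.-tuple h :=
  [tuple if k == i then u else tnth x k | k < m].

Definition tdel n (x : n.-tuple h) (i : 'I_n) : n.-1.-tuple h :=
  [tuple tnth x (lift i k) | k < n.-1].

(* The tuple (u, x_1, .., ^x_i, .., ^x_j, .., x_n). For i != j the list has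
   length n.-1, so that the default value 0 is never used. *)
Definition tdel2 n (u : h) (x : n.-tuple h) (i j : 'I_n) : n.-1.-tuple h :=
  [tuple nth 0 (u :: [seq tnth x k | k <- enum 'I_n & (k != i) && (k != j)]) l
  | l < n.-1].

(* C_Der^n(h, V), for n >= 1. An element of Hom(wedge^(n-1) h (x) h, V) is a
   function of n-1 arguments, collected in a tuple, and of a last argument; it
   is multilinear, and alternating in the tuple. Linearity in the last argument
   is part of is_Der. *)
Record is_cochain (n : nat) (f : n.-1.-tuple h -> h -> V) : Prop := IsCochain {
  cochain_linear : forall x i z, linear (fun u => f (tupd x i u) z);
  cochain_alternating : forall x i j z,
    i != j -> tnth x i = tnth x j -> f x z = 0;
  cochain_Der : forall x, is_Der (f x)
}.

(* Indices start at 0 here, hence (-1) ^+ i in place of (-1)^(i+1). *)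
Definition coboundary (n : nat) (f : n.-1.-tuple h -> h -> V)
    (x : n.-tuple h) (z : h) : V :=
  \sum_(i < n) (-1) ^+ i *: rep_mu R (tnth x i) (f (tdel x i) z)
  + \sum_(i < n) (-1) ^+ i *: rep_nu R z (f (tdel x i) (tnth x i))
  - \sum_(i < n) (-1) ^+ i *: f (tdel x i) (pl_tr P (tnth x i) z)
  + \sum_(i < n) \sum_(j < n | (i < j)%N) (-1) ^+ (i + j) *:
      f (tdel2 (pl_tr P (tnth x i) (tnth x j) - pl_tr P (tnth x j) (tnth x i)
                + pl_br P (tnth x i) (tnth x j)) x i j) z.

Definition is_cocycle (n : nat) (f : n.-1.-tuple h -> h -> V) : Prop :=
  is_cochain f /\ forall x z, coboundary f x z = 0.

End Cohomology.

Record postLieTriple := PostLieTriple {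
  tr_h : lmodType K;
  tr_postLie : postLie tr_h;
  tr_V : lmodType K;
  tr_rep : postLieRep tr_postLie tr_V;
  tr_omega : 2.-tuple tr_h -> tr_h -> tr_V;
  tr_omega_cocycle : is_cocycle (n := 3) tr_rep tr_omega
}.

(* A graded Lie algebra concentrated in degrees 0 and -1, given by the
   components of its degree 0 bracket, the suffixes being the (opposite)
   degrees of the arguments. The component on g_{-1} (x) g_{-1} takes its
   values in g_{-2} = 0. For the same reason all Koszul signs are trivial and
   the Jacobi identity has content only when at most one of its arguments lies
   in g_{-1}. *)
Record gradedLie2 (g0 g1 : lmodType K) := GradedLie2 {
  gbr00 : g0 -> g0 -> g0;
  gbr01 : g0 -> g1 -> g1;
  gbr10 : g1 -> g0 -> g1;
  gbr00_bilinear : bilinear gbr00;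
  gbr01_bilinear : bilinear gbr01;
  gbr10_bilinear : bilinear gbr10;
  gbr00_skew : forall x y, gbr00 x y = - gbr00 y x;
  gbr01_skew : forall x a, gbr01 x a = - gbr10 a x;
  gbr_jacobi000 : forall x y z,
    gbr00 x (gbr00 y z) = gbr00 (gbr00 x y) z + gbr00 y (gbr00 x z);
  gbr_jacobi001 : forall x y a,
    gbr01 x (gbr01 y a) = gbr01 (gbr00 x y) a + gbr01 y (gbr01 x a);
  gbr_jacobi010 : forall x a z,
    gbr01 x (gbr10 a z) = gbr10 (gbr01 x a) z + gbr10 a (gbr00 x z);
  gbr_jacobi100 : forall a y z,
    gbr10 a (gbr00 y z) = gbr10 (gbr10 a y) z + gbr01 y (gbr10 a z)
}.

Record OHPostLie2 (g0 g1 : lmodType K) := MkOHPostLie2 {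
  oh_lie : gradedLie2 g0 g1;
  Th1 : g1 -> g0;
  Th2_00 : g0 -> g0 -> g0;
  Th2_01 : g0 -> g1 -> g1;
  Th2_10 : g1 -> g0 -> g1;
  Th3 : g0 -> g0 -> g0 -> g1;
  Th1_linear : linear Th1;
  Th2_00_bilinear : bilinear Th2_00;
  Th2_01_bilinear : bilinear Th2_01;
  Th2_10_bilinear : bilinear Th2_10;
  Th3_bilinear : forall z, bilinear (fun x y => Th3 x y z);
  Th3_linear : forall x y, linear (Th3 x y);
  Th3_alternating : forall x z, Th3 x x z = 0;
  oh_a1 : forall x a,
    Th1 (gbr01 oh_lie x a) = gbr00 oh_lie x (Th1 a);
  oh_a2 : forall a b,
    gbr01 oh_lie (Th1 a) b = gbr10 oh_lie a (Th1 b);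
  oh_b1 : forall x y z,
    Th2_00 x (gbr00 oh_lie y z)
      = gbr00 oh_lie (Th2_00 x y) z + gbr00 oh_lie y (Th2_00 x z);
  oh_b2 : forall x y a,
    Th2_01 x (gbr01 oh_lie y a)
      = gbr01 oh_lie (Th2_00 x y) a + gbr01 oh_lie y (Th2_01 x a);
  oh_b3 : forall a x y,
    Th2_10 a (gbr00 oh_lie x y)
      = gbr10 oh_lie (Th2_10 a x) y + gbr01 oh_lie x (Th2_10 a y);
  oh_c : forall x y z w,
    Th3 x y (gbr00 oh_lie z w)
      = gbr10 oh_lie (Th3 x y z) w + gbr01 oh_lie z (Th3 x y w);
  oh_d1 : forall x a, Th1 (Th2_01 x a) = Th2_00 x (Th1 a);
  oh_d2 : forall a x, Th1 (Th2_10 a x) = Th2_00 (Th1 a) x;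
  oh_d3 : forall a b, Th2_01 (Th1 a) b = Th2_10 a (Th1 b);
  oh_e1 : forall x y z,
    Th2_00 x (Th2_00 y z) - Th2_00 (Th2_00 x y) z
    - Th2_00 y (Th2_00 x z) + Th2_00 (Th2_00 y x) z
    - Th2_00 (gbr00 oh_lie x y) z = Th1 (Th3 x y z);
  oh_e2 : forall x y a,
    Th2_01 x (Th2_01 y a) - Th2_01 (Th2_00 x y) a
    - Th2_01 y (Th2_01 x a) + Th2_01 (Th2_00 y x) a
    - Th2_01 (gbr00 oh_lie x y) a = Th3 x y (Th1 a);
  oh_e3 : forall a y z,
    Th2_10 a (Th2_00 y z) - Th2_10 (Th2_10 a y) z
    - Th2_01 y (Th2_10 a z) + Th2_10 (Th2_01 y a) z
    - Th2_10 (gbr10 oh_lie a y) z = Th3 (Th1 a) y z;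
  oh_f : forall x y z w,
    Th2_01 x (Th3 y z w) - Th2_01 y (Th3 x z w) + Th2_01 z (Th3 x y w)
    + Th2_10 (Th3 y z x) w - Th2_10 (Th3 x z y) w + Th2_10 (Th3 x y z) w
    - Th3 (Th2_00 x y - Th2_00 y x + gbr00 oh_lie x y) z w
    - Th3 (Th2_00 y z - Th2_00 z y + gbr00 oh_lie y z) x w
    + Th3 (Th2_00 x z - Th2_00 z x + gbr00 oh_lie x z) y w
    - Th3 y z (Th2_00 x w) + Th3 x z (Th2_00 y w) - Th3 x y (Th2_00 z w) = 0
}.

Definition skeletal (g0 g1 : lmodType K) (S : OHPostLie2 g0 g1) : Prop :=
  forall a, Th1 S a = 0.

Record skeletalOHPostLie2 := SkeletalOHPostLie2 {
  sk_g0 : lmodType K;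
  sk_g1 : lmodType K;
  sk_str : OHPostLie2 sk_g0 sk_g1;
  sk_skeletal : skeletal sk_str
}.

End PostLie.

Arguments postLieTriple K : clear implicits.
Arguments skeletalOHPostLie2 K : clear implicits.

(* Main.v *)
From Pilot Require Import Defs.
From HB Require Import structures.
From mathcomp Require Import all_boot all_order all_algebra.
From Stdlib Require Import FunctionalExtensionality ProofIrrelevance.

(** Put [h = g_0], [V = g_{-1}], and read a skeletal structure through the
dictionary
- the bracket and [Theta_2] on [g_0] are the Lie bracket and the product of [h];
- [rho(x) a = [x, a]], [mu(x) a = Theta_2(x, a)], [nu(x) a = Theta_2(a, x)];
- [omega = Theta_3].

Once [Theta_1 = 0], the axioms [oh_a1], [oh_a2], [oh_d1], [oh_d2], [oh_d3] say
that [0 = 0], and in [oh_e1], [oh_e2], [oh_e3] the right-hand sides vanish. What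
is left is, axiom by axiom, the other side of the dictionary:
- [oh_b1] and [oh_e1] are the two compatibilities of a post-Lie product;
- the Jacobi identity with one argument in [g_{-1}], with [oh_b2], [oh_b3],
  [oh_e2] and [oh_e3], gives the axioms of a representation;
- [oh_c] says that [Theta_3(x, y, -)] is a derivation, and [oh_f] is the cocycle
  equation of degree 3, the expansion of which is [coboundary3E].

So data satisfying the axioms on one side satisfy those on the other, up to
signs and the order of terms. The remaining content is that the dictionary
forgets nothing, so that the two passages are mutually inverse. The component of the bracket on [g_{-1} (x) g_0] is determined by skew symmetry
([gbr10_opp]), [Theta_1] is zero, and a function of two arguments is the same as
a function of the pair ([curry2K]). Structures with the same operations are
equal by proof irrelevance ([postLieTriple_ext], [skeletal_ext]).

Characteristic zero enters at one point: the bracket of the graded Lie algebra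
is skew-symmetric, that of the post-Lie algebra is alternating, and passing from
the former to the latter divides by 2 ([skew_alternating]). *)

Set Implicit Arguments.
Unset Strict Implicit.
Unset Printing Implicit Defensive.

Import GRing.Theory.
(* Makes [bilinear f] mean bilinearity over [K] of a curried function again. *)
Import Pilot.Defs.
Local Open Scope ring_scope.

(** * Linear and bilinear maps *)

Section Linearity.
Variable K : fieldType.
Implicit Types U V W : lmodType K.

Lemma opp_linear U V (f : U -> V) : linear f -> linear (fun u => - f u).
Proof. by move=> fL a u v; rewrite fL opprD scalerN. Qed.

Lemma linear_add U V (f : U -> V) : linear f -> {morph f : u v / u + v}.
Proof. by move=> fL u v; have := fL 1 u v; rewrite !scale1r. Qed.

Lemma linear0 U V (f : U -> V) : linear f -> f 0 = 0.
Proof.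
by move=> fL; have := linear_add fL 0 0; rewrite addr0 -[LHS]addr0 => /addrI.
Qed.

Lemma linear_opp U V (f : U -> V) : linear f -> {morph f : u / - u}.
Proof.
move=> fL u; apply/eqP; rewrite -addr_eq0 -(linear_add fL) addNr.
by rewrite (linear0 fL).
Qed.

Lemma bilinear0l U V W (f : U -> V -> W) v : bilinear f -> f 0 v = 0.
Proof. by case=> fl _; rewrite (linear0 (fl v)). Qed.

Lemma bilinear0r U V W (f : U -> V -> W) u : bilinear f -> f u 0 = 0.
Proof. by case=> _ fr; rewrite (linear0 (fr u)). Qed.

Lemma bilinear_flip U V W (f : U -> V -> W) :
  bilinear f -> bilinear (fun v u => f u v).
Proof. by case=> fl fr; split. Qed.

Lemma biopp_linear U V W (f : U -> V -> W) :
  bilinear f -> bilinear (fun u v => - f u v).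
Proof. by case=> fl fr; split=> u; apply: opp_linear. Qed.

Lemma alternating_skew U V (f : U -> U -> V) :
  bilinear f -> (forall x, f x x = 0) -> forall x y, f x y = - f y x.
Proof.
case=> fl fr f0 x y; apply/eqP; rewrite -addr_eq0; apply/eqP.
have := f0 (x + y).
by rewrite (linear_add (fl _)) !(linear_add (fr _)) !f0 add0r addr0.
Qed.

(** Skew symmetry gives [2 f(x, x) = 0], and 2 is invertible. *)
Lemma skew_alternating U V (f : U -> U -> V) : [pchar K] =i pred0 ->
  (forall x y, f x y = - f y x) -> forall x, f x x = 0.
Proof.
move=> charK0 fN x; have /eqP := fN x x.
rewrite -addr_eq0 -mulr2n -scaler_nat scaler_eq0.
by have /pcharf0P -> := charK0; move/eqP.
Qed.

End Linearity.

(** * Cochains of degree 3 and the expansion of their coboundary *)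

Section Cochains.
Variables (K : fieldType) (h V : lmodType K).

Definition uncurry2 (F : h -> h -> h -> V) (t : 2.-tuple h) (z : h) : V :=
  F (tnth t ord0) (tnth t ord_max) z.

Definition curry2 (w : 2.-tuple h -> h -> V) (x y z : h) : V :=
  w [tuple x; y] z.

Lemma tuple2_eta (t : 2.-tuple h) : [tuple tnth t ord0; tnth t ord_max] = t.
Proof.
apply: eq_from_tnth => -[[|[|//]] lt_i]; rewrite (tnth_nth 0) /=;
  by congr tnth; apply: val_inj.
Qed.

Lemma curry2K : cancel curry2 uncurry2.
Proof.
move=> w; apply: functional_extensionality => t.
by rewrite /uncurry2 /curry2 tuple2_eta.
Qed.

Variables (P : postLie h) (R : postLieRep P V).

Lemma tdel3 (x y z : h) :
  [/\ tdel [tuple x; y; z] ord0 = [tuple y; z],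
      tdel [tuple x; y; z] (lift ord0 ord0) = [tuple x; z]
    & tdel [tuple x; y; z] (lift ord0 (lift ord0 ord0)) = [tuple x; y]].
Proof.
by split; apply: eq_from_tnth => -[[|[|//]] lt_i];
  rewrite tnth_mktuple !(tnth_nth 0).
Qed.

Lemma tdel23 (u x y z : h) :
  [/\ tdel2 u [tuple x; y; z] ord0 (lift ord0 ord0) = [tuple u; z],
      tdel2 u [tuple x; y; z] ord0 (lift ord0 (lift ord0 ord0)) = [tuple u; y]
    & tdel2 u [tuple x; y; z] (lift ord0 ord0) (lift ord0 (lift ord0 ord0))
      = [tuple u; x]].
Proof.
by split; apply: eq_from_tnth => -[[|[|//]] lt_i];
  rewrite tnth_mktuple (tnth_nth 0) !enum_ordSl enum_ord0 /= ?(tnth_nth 0).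
Qed.

Lemma tuple3_eta (t : 3.-tuple h) :
  [tuple tnth t ord0; tnth t (lift ord0 ord0); tnth t ord_max] = t.
Proof.
apply: eq_from_tnth => -[[|[|[|//]]] lt_i]; rewrite (tnth_nth 0) /=;
  by congr tnth; apply: val_inj.
Qed.

(** A tuple of length 2 has only one pair of distinct positions, so that
alternation on tuples is the single identity [F x x z = 0]. *)
Lemma uncurry2_cochain (F : h -> h -> h -> V) :
  (forall z, bilinear (fun x y => F x y z)) -> (forall x z, F x x z = 0) ->
  (forall x y, is_Der R (F x y)) -> is_cochain (n := 3) R (uncurry2 F).
Proof.
move=> Fbil F0 FDer; split=> [t i z|t i j z neq_ij eq_t|t]; last exact: FDer.
- have [Fl Fr] := Fbil z; move=> a u v.
  rewrite /uncurry2 !tnth_mktuple.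
  by case: i => -[|[|//]] lt_i /=; [apply: Fl | apply: Fr].
- have {}eq_t : tnth t ord0 = tnth t ord_max.
    case: i j neq_ij eq_t => -[|[|//]] lti [[|[|//]] ltj] //= _ e;
    [|symmetry]; by congr (_ = _): e; congr tnth; apply: val_inj.
  by rewrite /uncurry2 eq_t.
Qed.

(** Multilinearity on tuples speaks of the update of one entry; both partial
maps are such updates, of a tuple whose entry to be overwritten is arbitrary
(here 0). *)
Lemma curry2_bilinear (w : 2.-tuple h -> h -> V) z :
  is_cochain (n := 3) R w -> bilinear (fun x y => curry2 w x y z).
Proof.
case=> wL _ _; split=> [y|x] a u v.
- have E t : curry2 w t y z = w (tupd [tuple 0; y] ord0 t) z.
    congr w; apply: eq_from_tnth => -[[|[|//]] lt_i];
    by rewrite tnth_mktuple !(tnth_nth 0).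
  by rewrite !E (wL _ _ z).
- have E t : curry2 w x t z = w (tupd [tuple x; 0] ord_max t) z.
    congr w; apply: eq_from_tnth => -[[|[|//]] lt_i];
    by rewrite tnth_mktuple !(tnth_nth 0).
  by rewrite !E (wL _ _ z).
Qed.

Lemma curry2_alternating (w : 2.-tuple h -> h -> V) x z :
  is_cochain (n := 3) R w -> curry2 w x x z = 0.
Proof. by case=> _ w0 _; apply: (w0 _ ord0 ord_max). Qed.

(** With [w] as [Theta_3] and the actions as [Theta_2], the right-hand side is
the left-hand side of [oh_f], term by term and in the same order. It is the
bridge between [oh_f] and the cocycle equation in both directions. *)
Lemma coboundary3E (w : 2.-tuple h -> h -> V) (x y z u : h) :
  let F := curry2 w in
  let D a b := pl_tr P a b - pl_tr P b a + pl_br P a b in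
  coboundary (n := 3) R w [tuple x; y; z] u =
    rep_mu R x (F y z u) - rep_mu R y (F x z u) + rep_mu R z (F x y u)
    + rep_nu R u (F y z x) - rep_nu R u (F x z y) + rep_nu R u (F x y z)
    - F (D x y) z u - F (D y z) x u + F (D x z) y u
    - F y z (pl_tr P x u) + F x z (pl_tr P y u) - F x y (pl_tr P z u).
Proof.
move=> F D; rewrite /coboundary.
under [X in _ + X]eq_bigr => i _ do rewrite big_mkcond /=.
rewrite !big_ord_recl !big_ord0 /= !addr0 !add0r.
have [-> -> ->] := tdel3 x y z.
rewrite /bump /= !addn0 !add0n !add1n.
rewrite (_ : tnth _ ord0 = x) // (_ : tnth _ (lift ord0 ord0) = y) //.
rewrite (_ : tnth _ (lift ord0 (lift ord0 ord0)) = z) //.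
have T a := tdel23 a x y z.
have [-> _ _] := T (D x y); have [_ -> _] := T (D x z).
have [_ _ ->] := T (D y z).
rewrite !exprS !expr0 !mulr1 !mulN1r !opprK !scale1r !scaleN1r.
rewrite !opprD !opprK !addrA.
(* Terms 7 to 9 act on the last argument; 10 to 12 insert [D] of the
   pairs (x,y), (x,z), (y,z), the last two of which are exchanged. *)
by rewrite [LHS](ACl (1*2*3*4*5*6*10*12*11*7*8*9)).
Qed.

End Cochains.

(** * From a skeletal structure to a cocycle *)

Section Correspondence.
Variables (K : fieldType) (h V : lmodType K).

Section ToTriple.
Hypothesis charK0 : [pchar K] =i pred0.
Variables (S : OHPostLie2 h V) (S_skel : skeletal S).

Lemma skeletal_lie : is_lie (gbr00 (oh_lie S)).
Proof.
split; [exact: gbr00_bilinear | | exact: gbr_jacobi000].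
by apply: skew_alternating => // x y; apply: gbr00_skew.
Qed.

Lemma skeletal_br_tr x y z :
  Th2_00 S (gbr00 (oh_lie S) x y) z
    = assoc (Th2_00 S) x y z - assoc (Th2_00 S) y x z.
Proof.
have /eqP := oh_e1 S x y z; rewrite S_skel subr_eq0 => /eqP <-.
by rewrite /assoc opprB addrA addrAC.
Qed.

Definition skeletal_postLie : postLie h :=
  PostLie skeletal_lie (Th2_00_bilinear S) (oh_b1 S) skeletal_br_tr.

Lemma skeletal_rho_br x y v :
  gbr01 (oh_lie S) (gbr00 (oh_lie S) x y) v
    = gbr01 (oh_lie S) x (gbr01 (oh_lie S) y v)
      - gbr01 (oh_lie S) y (gbr01 (oh_lie S) x v).
Proof. by rewrite gbr_jacobi001 addrK. Qed.

Lemma skeletal_rho_tr x y v :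
  gbr01 (oh_lie S) (Th2_00 S x y) v
    = Th2_01 S x (gbr01 (oh_lie S) y v) - gbr01 (oh_lie S) y (Th2_01 S x v).
Proof. by rewrite oh_b2 addrK. Qed.

Lemma gbr10_opp a x : gbr10 (oh_lie S) a x = - gbr01 (oh_lie S) x a.
Proof. by rewrite gbr01_skew opprK. Qed.

Lemma skeletal_nu_br x y v :
  Th2_10 S v (gbr00 (oh_lie S) x y)
    = gbr01 (oh_lie S) x (Th2_10 S v y) - gbr01 (oh_lie S) y (Th2_10 S v x).
Proof. by rewrite oh_b3 gbr10_opp addrC. Qed.

Lemma Th3_0l a y z : Th3 S (Th1 S a) y z = 0.
Proof.
by rewrite S_skel (bilinear0l _ (Th3_bilinear S z)).
Qed.

Lemma Th3_0r x y a : Th3 S x y (Th1 S a) = 0.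
Proof.
by rewrite S_skel (linear0 (Th3_linear S x y)).
Qed.

Lemma skeletal_mu_br x y v :
  Th2_01 S (gbr00 (oh_lie S) x y) v
    = Th2_01 S x (Th2_01 S y v) - Th2_01 S (Th2_00 S x y) v
      - Th2_01 S y (Th2_01 S x v) + Th2_01 S (Th2_00 S y x) v.
Proof.
by have /eqP := oh_e2 S x y v; rewrite Th3_0r subr_eq0 => /eqP ->.
Qed.

(** This is [oh_e3] solved for its last term, where the bracket of [a] and [y]
is [- rho(y) a]: this bracket is what brings [rho] into the compatibility of
[nu] with [mu]. *)
Lemma skeletal_nu_rho x y v :
  Th2_10 S (gbr01 (oh_lie S) x v) y
    = Th2_01 S x (Th2_10 S v y) - Th2_10 S (Th2_01 S x v) y
      - Th2_10 S v (Th2_00 S x y) + Th2_10 S (Th2_10 S v x) y.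
Proof.
have := oh_e3 S v x y; have [nul _] := Th2_10_bilinear S.
rewrite Th3_0l gbr10_opp (linear_opp (nul y)) opprK => /addr0_eq <-.
by rewrite !opprD !opprK [LHS](ACl (3*4*1*2)).
Qed.

Definition skeletal_rep : postLieRep skeletal_postLie V :=
  @PostLieRep K h skeletal_postLie V _ _ (fun x v => Th2_10 S v x)
    (gbr01_bilinear (oh_lie S)) (Th2_01_bilinear S)
    (bilinear_flip (Th2_10_bilinear S))
    skeletal_rho_br skeletal_rho_tr skeletal_nu_br skeletal_mu_br
    skeletal_nu_rho.

Lemma skeletal_cocycle : is_cocycle (n := 3) skeletal_rep (uncurry2 (Th3 S)).
Proof.
split.
  apply: uncurry2_cochain => [z|x z|x y].
  - exact: Th3_bilinear.
  - exact: Th3_alternating.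
  split; first exact: Th3_linear.
  by move=> z w; rewrite oh_c gbr10_opp addrC.
move=> t u; rewrite -[t]tuple3_eta coboundary3E; exact: oh_f.
Qed.

End ToTriple.

(** * From a triple back to a skeletal structure *)

Section ToSkeletal.
Variables (P : postLie h) (R : postLieRep P V) (w : 2.-tuple h -> h -> V).
Hypothesis w_cocycle : is_cocycle (n := 3) R w.

Lemma rep_jacobi010 x a z :
  rep_rho R x (- rep_rho R z a)
    = - rep_rho R z (rep_rho R x a) - rep_rho R (pl_br P x z) a.
Proof.
have [_ rhor] := rep_rho_bilinear R.
by rewrite (linear_opp (rhor x)) rep_rho_br opprB addKr.
Qed.

Lemma rep_jacobi100 a y z :
  - rep_rho R (pl_br P y z) a
    = - rep_rho R z (- rep_rho R y a) + rep_rho R y (- rep_rho R z a).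
Proof.
have [_ rhor] := rep_rho_bilinear R.
by rewrite !(linear_opp (rhor _)) rep_rho_br opprB opprK.
Qed.

Lemma rep_jacobi001 x y a :
  rep_rho R x (rep_rho R y a)
    = rep_rho R (pl_br P x y) a + rep_rho R y (rep_rho R x a).
Proof. by rewrite rep_rho_br subrK. Qed.

(** The semidirect product of [h] with the abelian Lie algebra [V], graded with
[h] in degree 0 and [V] in degree -1; its three mixed Jacobi identities all
restate that [rho] is a representation. *)
Definition semidirect_lie : gradedLie2 h V :=
  @GradedLie2 K h V _ _ (fun a x => - rep_rho R x a)
    (lie_bilinear (pl_br_lie P)) (rep_rho_bilinear R)
    (bilinear_flip (biopp_linear (rep_rho_bilinear R)))
    (alternating_skew (lie_bilinear (pl_br_lie P))
       (lie_alternating (pl_br_lie P)))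
    (fun x a => esym (opprK _))
    (lie_jacobi (pl_br_lie P)) rep_jacobi001 rep_jacobi010 rep_jacobi100.

Let zero1 : V -> h := fun=> 0.
Let G := semidirect_lie.
Let nuT := (fun a x => rep_nu R x a).
Let w3 := curry2 w.

Let nuT_bilinear : bilinear nuT := bilinear_flip (rep_nu_bilinear R).

Lemma zero_linear : linear zero1.
Proof. by move=> a u v; rewrite /zero1 scaler0 addr0. Qed.

Let w3_bilinear z : bilinear (fun x y => w3 x y z).
Proof. by case: w_cocycle => wC _; apply: curry2_bilinear wC. Qed.

Let w3_linear x y : linear (w3 x y).
Proof. by case: w_cocycle => -[_ _ wDer] _; case: (wDer [tuple x; y]). Qed.

Let w3_alternating x z : w3 x x z = 0.
Proof. by case: w_cocycle => wC _; apply: curry2_alternating wC. Qed.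

Let triple_a1 x a : zero1 (gbr01 G x a) = gbr00 G x (zero1 a).
Proof. by rewrite (bilinear0r _ (gbr00_bilinear G)). Qed.

Let triple_a2 a b : gbr01 G (zero1 a) b = gbr10 G a (zero1 b).
Proof.
by rewrite (bilinear0l _ (gbr01_bilinear G)) (bilinear0r _ (gbr10_bilinear G)).
Qed.

Let triple_b2 x y a :
  rep_mu R x (gbr01 G y a)
    = gbr01 G (pl_tr P x y) a + gbr01 G y (rep_mu R x a).
Proof. by rewrite /= rep_rho_tr subrK. Qed.

Let triple_b3 a x y :
  nuT a (gbr00 G x y) = gbr10 G (nuT a x) y + gbr01 G x (nuT a y).
Proof. by rewrite /nuT /= rep_nu_br addrC. Qed.

Let triple_c x y z t :
  w3 x y (gbr00 G z t) = gbr10 G (w3 x y z) t + gbr01 G z (w3 x y t).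
Proof.
case: w_cocycle => -[_ _ wDer] _; case: (wDer [tuple x; y]) => _ w_br.
by rewrite /w3 /curry2 /= w_br addrC.
Qed.

Let triple_d1 x a : zero1 (rep_mu R x a) = pl_tr P x (zero1 a).
Proof. by rewrite (bilinear0r _ (pl_tr_bilinear P)). Qed.

Let triple_d2 a x : zero1 (nuT a x) = pl_tr P (zero1 a) x.
Proof. by rewrite (bilinear0l _ (pl_tr_bilinear P)). Qed.

Let triple_d3 a b : rep_mu R (zero1 a) b = nuT a (zero1 b).
Proof.
by rewrite (bilinear0l _ (rep_mu_bilinear R)) (bilinear0r _ nuT_bilinear).
Qed.

Let triple_e1 x y z :
  pl_tr P x (pl_tr P y z) - pl_tr P (pl_tr P x y) z
  - pl_tr P y (pl_tr P x z) + pl_tr P (pl_tr P y x) z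
  - pl_tr P (gbr00 G x y) z = zero1 (w3 x y z).
Proof.
by apply/eqP; rewrite subr_eq0 /= pl_br_tr /assoc opprB addrA addrAC.
Qed.

Let triple_e2 x y a :
  rep_mu R x (rep_mu R y a) - rep_mu R (pl_tr P x y) a
  - rep_mu R y (rep_mu R x a) + rep_mu R (pl_tr P y x) a
  - rep_mu R (gbr00 G x y) a = w3 x y (zero1 a).
Proof. by rewrite (linear0 (w3_linear x y)) /= rep_mu_br subrr. Qed.

Let triple_e3 a y z :
  nuT a (pl_tr P y z) - nuT (nuT a y) z
  - rep_mu R y (nuT a z) + nuT (rep_mu R y a) z
  - nuT (gbr10 G a y) z = w3 (zero1 a) y z.
Proof.
rewrite (bilinear0l _ (w3_bilinear z)) /nuT /=.
have [_ nur] := rep_nu_bilinear R; rewrite (linear_opp (nur z)) opprK.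
rewrite rep_nu_rho; set p := rep_nu R _ _.
rewrite -[p - _ - _ + _]opprK; apply/eqP; rewrite addrC subr_eq0; apply/eqP.
by rewrite !opprD !opprK [RHS](ACl (3*4*1*2)).
Qed.

Let triple_f x y z t :
  rep_mu R x (w3 y z t) - rep_mu R y (w3 x z t) + rep_mu R z (w3 x y t)
  + nuT (w3 y z x) t - nuT (w3 x z y) t + nuT (w3 x y z) t
  - w3 (pl_tr P x y - pl_tr P y x + gbr00 G x y) z t
  - w3 (pl_tr P y z - pl_tr P z y + gbr00 G y z) x t
  + w3 (pl_tr P x z - pl_tr P z x + gbr00 G x z) y t
  - w3 y z (pl_tr P x t) + w3 x z (pl_tr P y t) - w3 x y (pl_tr P z t) = 0.
Proof.
by case: w_cocycle => _ /(_ [tuple x; y; z] t); rewrite coboundary3E.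
Qed.

Definition triple_structure : OHPostLie2 h V :=
  MkOHPostLie2 zero_linear (pl_tr_bilinear P) (rep_mu_bilinear R) nuT_bilinear
    w3_bilinear w3_linear w3_alternating triple_a1 triple_a2
    (pl_tr_derivation P : forall x y z, pl_tr P x (gbr00 G y z) =
       gbr00 G (pl_tr P x y) z + gbr00 G y (pl_tr P x z))
    triple_b2 triple_b3 triple_c triple_d1 triple_d2 triple_d3
    triple_e1 triple_e2 triple_e3 triple_f.

Lemma triple_skeletal : skeletal triple_structure.
Proof. by []. Qed.

End ToSkeletal.
End Correspondence.

(** * Structures with the same operations are equal *)

Section Extensionality.
Variables (K : fieldType) (h V : lmodType K).

Let funext2 (A B C : Type) (f g : A -> B -> C) : f =2 g -> f = g.
Proof. by move=> e; do 2![apply: functional_extensionality => ?]. Qed.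

(** The representation depends on the post-Lie algebra and the cocycle condition
on the representation. Identifying the layers from the bottom up keeps each
equation homogeneous, and no transport is needed. *)
Lemma postLieTriple_ext (P P' : postLie h) (R : postLieRep P V)
    (R' : postLieRep P' V) (w w' : 2.-tuple h -> h -> V)
    (wC : is_cocycle (n := 3) R w) (wC' : is_cocycle (n := 3) R' w') :
  pl_br P =2 pl_br P' -> pl_tr P =2 pl_tr P' -> rep_rho R =2 rep_rho R' ->
  rep_mu R =2 rep_mu R' -> rep_nu R =2 rep_nu R' -> w =2 w' ->
  PostLieTriple wC = PostLieTriple wC'.
Proof.
move=> /funext2 eq_br /funext2 eq_tr.
have eqP : P = P'.
  case: P P' eq_br eq_tr {R R' wC wC'} => br tr p1 p2 p3 p4.
  case=> br' tr' p1' p2' p3' p4' /= eq_br eq_tr; subst br' tr'.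
  by congr PostLie; apply: proof_irrelevance.
subst P' => {eq_br eq_tr}.
move=> /funext2 eq_rho /funext2 eq_mu /funext2 eq_nu /funext2 eq_w; subst w'.
have eqR : R = R'.
  case: R R' eq_rho eq_mu eq_nu {wC wC'} => rho mu nu p1 p2 p3 p4 p5 p6 p7 p8.
  case=> rho' mu' nu' p1' p2' p3' p4' p5' p6' p7' p8' /= e1 e2 e3.
  subst rho' mu' nu'; by congr PostLieRep; apply: proof_irrelevance.
by subst R'; congr PostLieTriple; apply: proof_irrelevance.
Qed.

(** [Theta_1] and the component of the bracket on [g_{-1} (x) g_0] are absent
from the hypotheses: the first is zero, the second is fixed by skew symmetry. *)
Lemma skeletal_ext (S S' : OHPostLie2 h V)
    (S_skel : skeletal S) (S'_skel : skeletal S') :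
  gbr00 (oh_lie S) =2 gbr00 (oh_lie S') ->
  gbr01 (oh_lie S) =2 gbr01 (oh_lie S') ->
  Th2_00 S =2 Th2_00 S' -> Th2_01 S =2 Th2_01 S' -> Th2_10 S =2 Th2_10 S' ->
  (forall x y z, Th3 S x y z = Th3 S' x y z) ->
  SkeletalOHPostLie2 S_skel = SkeletalOHPostLie2 S'_skel.
Proof.
move=> eq00 eq01 e00 e01 e10 e3.
have eq10 : gbr10 (oh_lie S) =2 gbr10 (oh_lie S').
  by move=> a x; rewrite !gbr10_opp eq01.
have eq_lie : oh_lie S = oh_lie S'.
  move: eq00 eq01 eq10 => /funext2 + /funext2 + /funext2.
  case: (oh_lie S) (oh_lie S') => b00 b01 b10 p1 p2 p3 p4 p5 p6 p7 p8 p9.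
  case=> b00' b01' b10' p1' p2' p3' p4' p5' p6' p7' p8' p9' /= q1 q2 q3.
  by subst b00' b01' b10'; congr GradedLie2; apply: proof_irrelevance.
have eq_Th1 : Th1 S = Th1 S'.
  by apply: functional_extensionality => a; rewrite S_skel S'_skel.
have {e3}eq_Th3 : Th3 S = Th3 S'.
  by do 3![apply: functional_extensionality => ?].
move: e00 e01 e10 => /funext2 + /funext2 + /funext2.
move=> e00 e01 e10.
have eqS : S = S'.
  case: S S' eq_lie eq_Th1 e00 e01 e10 eq_Th3
    {S_skel S'_skel eq00 eq01 eq10}.
  move=> L t1 t00 t01 t10 t3 p1 p2 p3 p4 p5 p6 p7 p8 p9 p10 p11 p12 p13 p14 p15.
  move=> p16 p17 p18 p19 p20 [L' t1' t00' t01' t10' t3'].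
  move=> q1 q2 q3 q4 q5 q6 q7 q8 q9 q10 q11 q12 q13 q14 q15 q16 q17 q18 q19 q20.
  move=> /= r1 r2 r3 r4 r5 r6; subst L' t1' t00' t01' t10' t3'.
  by congr MkOHPostLie2; apply: proof_irrelevance.
by subst S'; congr SkeletalOHPostLie2; apply: proof_irrelevance.
Qed.

End Extensionality.

(** * The correspondence *)

Theorem theorem4p16 (K : fieldType) (charK0 : [pchar K] =i pred0) :
  exists Phi : skeletalOHPostLie2 K -> postLieTriple K,
    bijective Phi /\
    (* Phi keeps the underlying spaces, h = g_0 and V = g_{-1}, and is given by
       the components of the bracket and of Theta_2, Theta_3. *)
    forall (g0 g1 : lmodType K) (S : OHPostLie2 g0 g1) (S_skel : skeletal S),
      exists (P : postLie g0) (R : postLieRep P g1)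
             (omega : 2.-tuple g0 -> g0 -> g1)
             (omega_cocycle : is_cocycle (n := 3) R omega),
        Phi (SkeletalOHPostLie2 S_skel) = PostLieTriple omega_cocycle /\
        [/\ forall x y, pl_br P x y = gbr00 (oh_lie S) x y
                        /\ pl_tr P x y = Th2_00 S x y,
            forall x a, rep_rho R x a = gbr01 (oh_lie S) x a,
            forall x a, rep_mu R x a = Th2_01 S x a,
            forall x a, rep_nu R x a = Th2_10 S a x
          & forall x y z, omega [tuple x; y] z = Th3 S x y z].
Proof.
pose Phi (T : skeletalOHPostLie2 K) :=
  PostLieTriple (skeletal_cocycle charK0 (@sk_skeletal K T)).
pose Psi (T : postLieTriple K) :=
  SkeletalOHPostLie2 (triple_skeletal (tr_omega_cocycle T)).
exists Phi; split.
  exists Psi.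
  - by case=> g0 g1 S S_skel; apply: skeletal_ext.
  - case=> h P V R w wC; apply: postLieTriple_ext => // t z.
    by rewrite /= curry2K.
move=> g0 g1 S S_skel.
by do 3!eexists; exists (skeletal_cocycle charK0 S_skel).
Qed.
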